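(* Let $D$ be an ind-flat finite poset and let $\mathcal{E}$ be a Frobenius category. Then the residue class functor $\mathcal{E}^{\mathrm{mono}}(D)\to\underline{\mathcal{E}}(D)$, $X\mapsto\underline{X}$, is dense, i.e. every object of $\underline{\mathcal{E}}(D)$ is isomorphic in $\underline{\mathcal{E}}(D)$ to $\underline{X}$ for some object $X$ of $\mathcal{E}^{\mathrm{mono}}(D)$.
   Context: Posets. A poset is considered as a category with exactly one morphism $p\to q$ if $p\le q$, and none otherwise. For a finite poset $P$ and $p\in P$ put $\Lambda(p)=\{q\in P: q\le p\}$ and $\Lambda^0(p)=\{q\in P: q<p\}$, with the order induced from $P$; $\max(P)$ is the set of maximal elements of $P$. The poset $\mathrm{ind\text{-}crown}(P)$ has underlying set $\bigcup_{p,q\in\max(P)}\max(\Lambda(p)\cap\Lambda(q))$ (the case $p=q$ is included), and strict order: $r<s$ in $\mathrm{ind\text{-}crown}(P)$ iff $r<s$ in $P$, $r\notin\max(P)$ and $s\in\max(P)$. Crowns. A crown is a finite poset $C$ with no elements $c<c'<c''$; each $\mathrm{ind\text{-}crown}(P)$ is a crown. Let $\mathrm{Mor}'C$ be the set of non-identity morphisms of $C$. The crown $C$ is componentwise $1$-connected if the $\mathbb{Q}$-linear map $\mathbb{Q}[\mathrm{Mor}'C]\to\mathbb{Q}[\mathrm{Ob}\,C]$, $(c\to d)\mapsto d-c$, between the $\mathbb{Q}$-vector spaces with the indicated bases, is injective. A finite poset $D$ is ind-flat if $\mathrm{ind\text{-}crown}(\Lambda^0(d))$ is componentwise $1$-connected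 for each $d\in D$. Frobenius categories. A Frobenius category $\mathcal{E}$ is an exact category (in the sense of Quillen, with its pure monomorphisms and pure epimorphisms, i.e. admissible ones) such that for each object $X$ there are a pure epimorphism $N\to X$ and a pure monomorphism $X\to N'$ with $N,N'$ bijective, i.e. both projective and injective relative to the pure short exact sequences. $\underline{\mathcal{E}}$ denotes its classical stable category: same objects as $\mathcal{E}$, morphisms being residue classes of morphisms of $\mathcal{E}$ modulo those that factor over a bijective object. Diagrams. For a category $\mathcal{C}$, $\mathcal{C}(D)$ is the category of functors from $D$ to $\mathcal{C}$ and natural transformations. $\mathcal{E}^{\mathrm{mono}}(D)$ is the full subcategory of $\mathcal{E}(D)$ of those diagrams $X$ for which $X(a\to b)$ is a pure monomorphism for all $a\le b$ in $D$. $\underline{X}$ is the composite of $X:D\to\mathcal{E}$ with the residue class functor $\mathcal{E}\to\underline{\mathcal{E}}$. *)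

(* Defs.v *)
From HB Require Import structures.
From mathcomp Require Import all_boot all_order all_algebra.
From mathcomp Require Import boolp.

Set Implicit Arguments.
Unset Strict Implicit.
Unset Printing Implicit Defensive.

Import Order.TTheory GRing.Theory.

#[local] Obligation Tactic := idtac.

Declare Scope cat_scope.
Delimit Scope cat_scope with cat.
Local Open Scope cat_scope.

(** * Finite posets and crowns *)

Section Posets.
Local Open Scope order_scope.
Context {disp : Order.disp_t} {T : finPOrderType disp}.
Implicit Types (P : {set T}) (p q : T).

(* A set [P : {set T}] stands for the poset [P] with the order induced from
   [T]; the poset [T] itself is [[set: T]]. *)

Definition max_set P : {set T} :=
  [set p in P | [forall q in P, ~~ (p < q)]].

Definition down P p : {set T} := [set q in P | q <= p].

Definition down0 P p : {set T} := [set q in P | q < p].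

Definition ind_crown_set P : {set T} :=
  \bigcup_(p in max_set P) \bigcup_(q in max_set P)
     max_set (down P p :&: down P q).

Definition ind_crown P : Type := {r : T | r \in ind_crown_set P}.

Section IndCrown.
Variable P : {set T}.

HB.instance Definition _ :=
  SubFinite.copy (ind_crown P) {r : T | r \in ind_crown_set P}.

Definition ind_crown_lt (r s : ind_crown P) : bool :=
  [&& val r < val s, val r \notin max_set P & val s \in max_set P].

Lemma ind_crown_lt_irr : irreflexive ind_crown_lt.
Proof. by move=> r; rewrite /ind_crown_lt ltxx. Qed.

Lemma ind_crown_lt_trans : transitive ind_crown_lt.
Proof. by move=> s r t /and3P[_ _ sP] /and3P[_ /negP]. Qed.

End IndCrown.
End Posets.

Fact ind_crown_display : Order.disp_t. Proof. by []. Qed.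

HB.instance Definition _ disp (T : finPOrderType disp) (P : {set T}) :=
  Order.Lt_isPOrder.Build ind_crown_display (ind_crown P)
    (@ind_crown_lt_irr _ _ P) (@ind_crown_lt_trans _ _ P).

Definition is_crown disp (C : finPOrderType disp) : Prop :=
  forall c c' c'' : C, ~ ((c < c')%O /\ (c' < c'')%O).

Lemma ind_crown_is_crown disp (T : finPOrderType disp) (P : {set T}) :
  is_crown (ind_crown P).
Proof. by move=> c c' c'' [/and3P[_ _ cP] /and3P[_ /negP]]. Qed.

Section Crowns.
Local Open Scope ring_scope.
Context {disp : Order.disp_t}.
Variable C : finPOrderType disp.

(* In the poset category [C], the non-identity morphisms are the pairs
   [c < d]. *)
Definition nonid_mor : Type := {e : C * C | (e.1 < e.2)%O}.
HB.instance Definition _ :=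
  SubFinite.copy nonid_mor {e : C * C | (e.1 < e.2)%O}.

Definition basis_vec (c : C) : {ffun C -> rat^o} := [ffun x => (x == c)%:R].

(* [{ffun I -> rat^o}] is the rational vector space with basis [I]. *)
Definition crown_boundary (a : {ffun nonid_mor -> rat^o}) : {ffun C -> rat^o} :=
  \sum_(e : nonid_mor) a e *: (basis_vec (val e).2 - basis_vec (val e).1).

Definition componentwise_1_connected : Prop := injective crown_boundary.

End Crowns.

Definition ind_flat disp (D : finPOrderType disp) : Prop :=
  forall d : D, componentwise_1_connected (ind_crown (down0 [set: D] d)).

(** * Categories and functors *)

Record category := Category {
  ob :> Type;
  hom : ob -> ob -> Type;
  idm : forall X, hom X X;
  comp : forall X Y Z, hom Y Z -> hom X Y -> hom X Z;
  compA : forall W X Y Z (h : hom Y Z) (g : hom X Y) (f : hom W X),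
    comp h (comp g f) = comp (comp h g) f;
  comp1m : forall X Y (f : hom X Y), comp (idm Y) f = f;
  compm1 : forall X Y (f : hom X Y), comp f (idm X) = f
}.

Arguments hom {c} X Y.
Arguments idm {c} X.
Arguments comp {c X Y Z} g f.
Notation "X ~> Y" := (hom X Y) (at level 90, right associativity) : cat_scope.
Notation "g '\oc' f" := (comp g f) (at level 40, left associativity) : cat_scope.

Definition is_iso (C : category) (X Y : C) (f : X ~> Y) : Prop :=
  exists g : Y ~> X, g \oc f = idm X /\ f \oc g = idm Y.

Definition isomorphic (C : category) (X Y : C) : Prop :=
  exists f : X ~> Y, is_iso f.

Record functor (C D : category) := Functor {
  fob :> C -> D;
  fmap : forall X Y : C, (X ~> Y) -> (fob X ~> fob Y);
  fmap1 : forall X : C, fmap (idm X) = idm (fob X);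
  fmapM : forall (X Y Z : C) (g : Y ~> Z) (f : X ~> Y),
    fmap (g \oc f) = fmap g \oc fmap f
}.
Arguments fmap {C D} F {X Y} f : rename.

Definition dense_functor (C D : category) (F : functor C D) : Prop :=
  forall Y : D, exists X : C, isomorphic (F X) Y.

Program Definition functor_comp (B C D : category)
    (G : functor C D) (F : functor B C) : functor B D :=
  @Functor B D (fun X => G (F X)) (fun X Y f => fmap G (fmap F f)) _ _.
Next Obligation. by move=> * /=; rewrite !fmap1. Qed.
Next Obligation. by move=> * /=; rewrite !fmapM. Qed.

Record nat_trans (C D : category) (F G : functor C D) := NatTrans {
  component :> forall X : C, F X ~> G X;
  naturality : forall (X Y : C) (f : X ~> Y),
    component Y \oc fmap F f = fmap G f \oc component X
}.

Lemma nat_transP (C D : category) (F G : functor C D) (s t : nat_trans F G) :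
  (forall X, s X = t X) -> s = t.
Proof.
case: s t => [s sN] [t tN] /= st.
have {st} est : s = t by exact: functional_extensionality_dep.
by subst t; congr NatTrans; exact: Prop_irrelevance.
Qed.

Section FunctorCategory.
Variables C D : category.

Program Definition nat_id (F : functor C D) : nat_trans F F :=
  @NatTrans C D F F (fun X => idm (F X)) _.
Next Obligation. by move=> *; rewrite comp1m compm1. Qed.

Program Definition nat_comp (F G H : functor C D)
    (t : nat_trans G H) (s : nat_trans F G) : nat_trans F H :=
  @NatTrans C D F H (fun X => t X \oc s X) _.
Next Obligation.
by move=> F G H t s X Y f; rewrite -compA naturality !compA naturality.
Qed.

Program Definition functor_category : category :=
  @Category (functor C D) (@nat_trans C D) nat_id nat_comp _ _ _.
Next Obligation. by move=> *; apply: nat_transP => X /=; rewrite compA. Qed.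
Next Obligation. by move=> *; apply: nat_transP => X /=; rewrite comp1m. Qed.
Next Obligation. by move=> *; apply: nat_transP => X /=; rewrite compm1. Qed.

End FunctorCategory.

Program Definition postcomp (B C D : category) (G : functor C D) :
    functor (functor_category B C) (functor_category B D) :=
  @Functor (functor_category B C) (functor_category B D)
    (fun F : functor B C => functor_comp G F)
    (fun (F F' : functor B C) (s : nat_trans F F') =>
       @NatTrans B D (functor_comp G F) (functor_comp G F')
         (fun X => fmap G (s X)) _) _ _.
Next Obligation. by move=> *; rewrite /= -!fmapM naturality. Qed.
Next Obligation. by move=> *; apply: nat_transP => X /=; rewrite fmap1. Qed.
Next Obligation. by move=> *; apply: nat_transP => X /=; rewrite fmapM. Qed.

Section FullSubcategory.
Variables (C : category) (P : C -> Prop).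

Program Definition full_subcategory : category :=
  @Category {X : C | P X} (fun X Y => sval X ~> sval Y)
    (fun X => idm (sval X)) (fun X Y Z g f => g \oc f) _ _ _.
Next Obligation. by move=> *; exact: compA. Qed.
Next Obligation. by move=> *; exact: comp1m. Qed.
Next Obligation. by move=> *; exact: compm1. Qed.

Program Definition full_inclusion : functor full_subcategory C :=
  @Functor full_subcategory C (fun X => sval X) (fun X Y f => f) _ _.
Next Obligation. by []. Qed.
Next Obligation. by []. Qed.

End FullSubcategory.

Program Definition poset_category disp (D : porderType disp) : category :=
  @Category D (fun p q => (p <= q)%O) (fun p => lexx p)
    (fun p q r (qr : (q <= r)%O) (pq : (p <= q)%O) => le_trans pq qr) _ _ _.
Next Obligation. by move=> *; exact: bool_irrelevance. Qed.
Next Obligation. by move=> *; exact: bool_irrelevance. Qed.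
Next Obligation. by move=> *; exact: bool_irrelevance. Qed.

Definition diagrams disp (D : porderType disp) (C : category) : category :=
  functor_category (poset_category D) C.

(** * Additive categories *)

(* Abelian group structures on the hom-sets, with composition not yet required
   to be bilinear. A MathComp Zmodule also carries a choice operator, which is
   no restriction under the classical axioms used here. *)
Record hom_zmod_category := HomZmodCategory {
  hz_cat :> category;
  hz_zmod : forall X Y : hz_cat, GRing.Zmodule (X ~> Y)
}.

HB.instance Definition _ (A : hom_zmod_category) (X Y : A) := @hz_zmod A X Y.

Local Open Scope ring_scope.

Definition is_biproduct (A : hom_zmod_category) (X Y S : A)
    (i : X ~> S) (j : Y ~> S) (p : S ~> X) (q : S ~> Y) : Prop :=
  [/\ p \oc i = idm X, q \oc j = idm Y, q \oc i = 0, p \oc j = 0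
    & i \oc p + j \oc q = idm S].

Record additive_category := AdditiveCategory {
  add_hz :> hom_zmod_category;
  compDl : forall (X Y Z : add_hz) (g g' : Y ~> Z) (f : X ~> Y),
    (g + g') \oc f = g \oc f + g' \oc f;
  compDr : forall (X Y Z : add_hz) (g : Y ~> Z) (f f' : X ~> Y),
    g \oc (f + f') = g \oc f + g \oc f';
  zero_object : exists Z : add_hz, idm Z = 0;
  biproducts : forall X Y : add_hz,
    exists (S : add_hz) (i : X ~> S) (j : Y ~> S) (p : S ~> X) (q : S ~> Y),
      is_biproduct i j p q
}.

Section AdditiveTheory.
Variable A : additive_category.
Implicit Types X Y Z : A.

Lemma comp0m X Y Z (f : X ~> Y) : (0 : Y ~> Z) \oc f = 0.
Proof. by apply: (addrI ((0 : Y ~> Z) \oc f)); rewrite -compDl !addr0. Qed.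

Lemma compm0 X Y Z (g : Y ~> Z) : g \oc (0 : X ~> Y) = 0.
Proof. by apply: (addrI (g \oc (0 : X ~> Y))); rewrite -compDr !addr0. Qed.

Lemma compNm X Y Z (g : Y ~> Z) (f : X ~> Y) : (- g) \oc f = - (g \oc f).
Proof. by apply: (addrI (g \oc f)); rewrite -compDl !subrr comp0m. Qed.

Lemma compmN X Y Z (g : Y ~> Z) (f : X ~> Y) : g \oc (- f) = - (g \oc f).
Proof. by apply: (addrI (g \oc f)); rewrite -compDr !subrr compm0. Qed.

Lemma compBl X Y Z (g g' : Y ~> Z) (f : X ~> Y) :
  (g - g') \oc f = g \oc f - g' \oc f.
Proof. by rewrite compDl compNm. Qed.

Lemma compBr X Y Z (g : Y ~> Z) (f f' : X ~> Y) :
  g \oc (f - f') = g \oc f - g \oc f'.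
Proof. by rewrite compDr compmN. Qed.

End AdditiveTheory.

(** * Exact categories *)

Section Limits.
Variable A : additive_category.
Implicit Types X Y Z W : A.

Definition is_kernel X Y Z (i : X ~> Y) (p : Y ~> Z) : Prop :=
  p \oc i = 0 /\
  forall W (f : W ~> Y), p \oc f = 0 -> exists! g : W ~> X, i \oc g = f.

Definition is_cokernel X Y Z (i : X ~> Y) (p : Y ~> Z) : Prop :=
  p \oc i = 0 /\
  forall W (f : Y ~> W), f \oc i = 0 -> exists! g : Z ~> W, g \oc p = f.

Definition is_pullback X Y Z P
    (f : X ~> Z) (g : Y ~> Z) (f' : P ~> Y) (g' : P ~> X) : Prop :=
  f \oc g' = g \oc f' /\
  forall W (u : W ~> X) (v : W ~> Y), f \oc u = g \oc v ->
    exists! h : W ~> P, g' \oc h = u /\ f' \oc h = v.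

Definition is_pushout X Y Z P
    (f : Z ~> X) (g : Z ~> Y) (f' : Y ~> P) (g' : X ~> P) : Prop :=
  g' \oc f = f' \oc g /\
  forall W (u : X ~> W) (v : Y ~> W), u \oc f = v \oc g ->
    exists! h : P ~> W, h \oc g' = u /\ h \oc f' = v.

End Limits.

(* A class of composable pairs X -> Y -> Z, the candidate pure short exact
   sequences. *)
Definition ses_class (A : additive_category) : Type :=
  forall X Y Z : A, (X ~> Y) -> (Y ~> Z) -> Prop.

Definition is_pure_mono (A : additive_category) (S : ses_class A)
    (X Y : A) (i : X ~> Y) : Prop := exists (Z : A) (p : Y ~> Z), S X Y Z i p.

Definition is_pure_epi (A : additive_category) (S : ses_class A)
    (Y Z : A) (p : Y ~> Z) : Prop := exists (X : A) (i : X ~> Y), S X Y Z i p.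

(* Quillen's original axioms, including the ("obscure") axioms
   [exact_epi_cancel] and [exact_mono_cancel], which Keller showed to follow
   from the others. *)
Record is_exact (A : additive_category) (S : ses_class A) : Prop := IsExact {
  exact_iso : forall (X Y Z X' Y' Z' : A) (i : X ~> Y) (p : Y ~> Z)
      (i' : X' ~> Y') (p' : Y' ~> Z') (x : X ~> X') (y : Y ~> Y') (z : Z ~> Z'),
    is_iso x -> is_iso y -> is_iso z ->
    y \oc i = i' \oc x -> z \oc p = p' \oc y -> S _ _ _ i p -> S _ _ _ i' p';
  exact_split : forall (X Y B : A)
      (i : X ~> B) (j : Y ~> B) (p : B ~> X) (q : B ~> Y),
    is_biproduct i j p q -> S _ _ _ i q;
  exact_kernel : forall (X Y Z : A) (i : X ~> Y) (p : Y ~> Z),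
    S _ _ _ i p -> is_kernel i p;
  exact_cokernel : forall (X Y Z : A) (i : X ~> Y) (p : Y ~> Z),
    S _ _ _ i p -> is_cokernel i p;
  exact_epi_comp : forall (X Y Z : A) (q : Y ~> Z) (p : X ~> Y),
    is_pure_epi S q -> is_pure_epi S p -> is_pure_epi S (q \oc p);
  exact_epi_pullback : forall (X Y Z : A) (p : X ~> Z) (g : Y ~> Z),
    is_pure_epi S p ->
    exists (P : A) (p' : P ~> Y) (g' : P ~> X),
      is_pullback p g p' g' /\ is_pure_epi S p';
  exact_mono_comp : forall (X Y Z : A) (j : Y ~> Z) (i : X ~> Y),
    is_pure_mono S j -> is_pure_mono S i -> is_pure_mono S (j \oc i);
  exact_mono_pushout : forall (X Y Z : A) (i : Z ~> X) (g : Z ~> Y),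
    is_pure_mono S i ->
    exists (P : A) (i' : Y ~> P) (g' : X ~> P),
      is_pushout i g i' g' /\ is_pure_mono S i';
  exact_epi_cancel : forall (X Y Z : A) (p : Y ~> Z) (f : X ~> Y),
    (exists (K : A) (k : K ~> Y), is_kernel k p) ->
    is_pure_epi S (p \oc f) -> is_pure_epi S p;
  exact_mono_cancel : forall (X Y Z : A) (i : X ~> Y) (f : Y ~> Z),
    (exists (K : A) (k : Y ~> K), is_cokernel i k) ->
    is_pure_mono S (f \oc i) -> is_pure_mono S i
}.

Record exact_category := ExactCategory {
  ex_add :> additive_category;
  pure_ses : ses_class ex_add;
  pure_sesP : is_exact pure_ses
}.

(** * Frobenius categories and stable categories *)

Section Bijectives.
Variable E : exact_category.
Implicit Types X Y Z N : E.

Definition pure_mono X Y (i : X ~> Y) : Prop := is_pure_mono (@pure_ses E) i.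

Definition pure_epi X Y (p : X ~> Y) : Prop := is_pure_epi (@pure_ses E) p.

Definition projective N : Prop :=
  forall X Y (p : X ~> Y) (f : N ~> Y), pure_epi p ->
    exists g : N ~> X, p \oc g = f.

Definition injective_object N : Prop :=
  forall X Y (i : X ~> Y) (f : X ~> N), pure_mono i ->
    exists g : Y ~> N, g \oc i = f.

Definition bijective_object N : Prop := projective N /\ injective_object N.

(* The residue classes below are taken modulo these morphisms; that they form
   a subgroup is [null_zmod_closed]. *)
Definition factors_over_bijective X Y (f : X ~> Y) : Prop :=
  exists (N : E) (u : X ~> N) (v : N ~> Y), bijective_object N /\ f = v \oc u.

Lemma zero_bijective Z : idm Z = 0 -> bijective_object Z.
Proof.
move=> Z0; split=> X Y g f _; exists 0.
- by rewrite -[f]compm1 Z0 !compm0.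
- by rewrite -[f]comp1m Z0 !comp0m.
Qed.

Lemma biproduct_bijective N N' B (i : N ~> B) (j : N' ~> B) p q :
  is_biproduct i j p q -> bijective_object N -> bijective_object N' ->
  bijective_object B.
Proof.
move=> [_ _ _ _ B1] [prN inN] [prN' inN']; split=> X Y g f gP.
- have [u uP] := prN X Y g (f \oc i) gP.
  have [v vP] := prN' X Y g (f \oc j) gP.
  exists (u \oc p + v \oc q).
  by rewrite compDr !compA uP vP -!compA -compDr B1 compm1.
- have [u uP] := inN X Y g (p \oc f) gP.
  have [v vP] := inN' X Y g (q \oc f) gP.
  exists (i \oc u + j \oc v).
  by rewrite compDl -!compA uP vP !compA -compDl B1 comp1m.
Qed.

Definition null_pred X Y : {pred X ~> Y} :=
  fun f => `[< factors_over_bijective f >].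

Lemma null_zmod_closed X Y : zmod_closed (@null_pred X Y).
Proof.
split; first apply/asboolP.
  have [Z Z0] := zero_object E; exists Z, 0, 0; split; last by rewrite comp0m.
  exact: zero_bijective.
move=> f g /asboolP[N [u [v [bN ->]]]] /asboolP[N' [u' [v' [bN' ->]]]].
apply/asboolP; have [B [i [j [p [q bP]]]]] := biproducts N N'.
exists B, (i \oc u - j \oc u'), (v \oc p + v' \oc q).
split; first exact: biproduct_bijective bP bN bN'.
case: bP => pi qj qi pj _.
rewrite compDl !compBr !compA -!(compA _ p) -!(compA _ q) pi qj qi pj.
by rewrite !compm1 !compm0 !comp0m subr0 sub0r.
Qed.

HB.instance Definition _ X Y :=
  GRing.isZmodClosed.Build (X ~> Y) (@null_pred X Y) (@null_zmod_closed X Y).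

Lemma null_compl X Y Z (g : Y ~> Z) (f : X ~> Y) :
  f \in @null_pred X Y -> g \oc f \in @null_pred X Z.
Proof.
move=> /asboolP[N [u [v [bN ->]]]]; apply/asboolP.
by exists N, u, (g \oc v); rewrite compA.
Qed.

Lemma null_compr X Y Z (g : Y ~> Z) (f : X ~> Y) :
  g \in @null_pred Y Z -> g \oc f \in @null_pred X Z.
Proof.
move=> /asboolP[N [u [v [bN ->]]]]; apply/asboolP.
by exists N, (u \oc f), v; rewrite compA.
Qed.

Local Open Scope quotient_scope.

Definition stable_hom X Y : Type := Quotient.quot (@null_pred X Y).

Definition residue X Y (f : X ~> Y) : stable_hom X Y :=
  \pi_(Quotient.quot (@null_pred X Y)) f.

Definition stable_comp X Y Z (g : stable_hom Y Z) (f : stable_hom X Y) :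
    stable_hom X Z :=
  residue (repr g \oc repr f).

Lemma residue_eq X Y (f g : X ~> Y) :
  residue f = residue g <-> factors_over_bijective (f - g).
Proof.
rewrite (rwP eqP) -(Quotient.idealrBE (@null_pred X Y)); split=> [/asboolP//|].
by move=> fg; apply/asboolP.
Qed.

Lemma residue_repr X Y (f : stable_hom X Y) : residue (repr f) = f.
Proof. exact: reprK. Qed.

Lemma residue_comp X Y Z (g : Y ~> Z) (f : X ~> Y) :
  residue (g \oc f) = stable_comp (residue g) (residue f).
Proof.
apply/residue_eq/asboolP.
set g' := repr _; set f' := repr _.
have /residue_eq/asboolP gg' : residue g = residue g' by rewrite residue_repr.
have /residue_eq/asboolP ff' : residue f = residue f' by rewrite residue_repr.
have -> : g \oc f - g' \oc f' = (g - g') \oc f + g' \oc (f - f').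
  by rewrite compBl compBr addrA addrNK.
by apply: (rpredD (null_compr f gg') (null_compl g' ff')).
Qed.

End Bijectives.

Section Stable.
Variable E : exact_category.

Program Definition stable_category : category :=
  @Category E (@stable_hom E) (fun X => residue (idm X)) (@stable_comp E) _ _ _.
Next Obligation.
move=> W X Y Z h g f.
by rewrite -(residue_repr h) -(residue_repr g) -(residue_repr f)
  -!residue_comp compA.
Qed.
Next Obligation.
by move=> X Y f; rewrite -[in LHS](residue_repr f) -residue_comp comp1m
  residue_repr.
Qed.
Next Obligation.
by move=> X Y f; rewrite -[in LHS](residue_repr f) -residue_comp compm1
  residue_repr.
Qed.

Program Definition residue_functor : functor E stable_category :=
  @Functor E stable_category (fun X => X) (@residue E) _ _.
Next Obligation. by []. Qed.
Next Obligation. by move=> *; exact: residue_comp. Qed.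

End Stable.

Record frobenius_category := FrobeniusCategory {
  frob_ex :> exact_category;
  enough_bijectives_epi : forall X : frob_ex,
    exists (N : frob_ex) (p : N ~> X), bijective_object N /\ pure_epi p;
  enough_bijectives_mono : forall X : frob_ex,
    exists (N : frob_ex) (i : X ~> N), bijective_object N /\ pure_mono i
}.

(** * Diagrams of pure monomorphisms *)

Section Diagrams.
Context {disp : Order.disp_t}.
Variables (D : porderType disp) (E : exact_category).

Definition is_mono_diagram (X : diagrams D E) : Prop :=
  forall (a b : poset_category D) (ab : a ~> b),
    pure_mono (fmap (X : functor (poset_category D) E) ab).

Definition mono_diagrams : category := full_subcategory is_mono_diagram.

Definition mono_residue :
    functor mono_diagrams (diagrams D (stable_category E)) :=
  functor_comp (postcomp (poset_category D) (residue_functor E))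
               (full_inclusion is_mono_diagram).

End Diagrams.

(* Main.v *)
From mathcomp Require Import all_boot all_order all_algebra.
From mathcomp Require Import boolp.
Require Import Defs.

(** A lift of [X] is built one element of [D] at a time, in an order in which
    every [d] comes after the elements below it. Suppose that [X] has been
    lifted, up to a stable isomorphism [phi], to a diagram [Y] of pure
    monomorphisms on a down-closed set containing $\Lambda^0(d)$. The maps
    [X (a -> d) \oc phi a] form a cocone on [Y] in the stable category. What has
    to be found is an object [B], stably isomorphic to [X d], with a cocone of
    pure monomorphisms from [Y] to [B] that commutes in [E] and represents this
    stable cocone.

    Since any common lower bound of two maximal elements lies below a maximal
    common lower bound, a cocone on $\Lambda^0(d)$ is the same thing as a
    cocone on its ind-crown ([cocone_of_crown_cocone]). The ind-crown is a
    forest: a nonempty finite graph in which every vertex has at least two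
    neighbours has no fewer edges than vertices, and then the boundary map,
    whose image consists of vectors with coordinate sum zero, is not injective
    ([exists_leaf]). So the crown is obtained by attaching leaves successively
    ([leaf_ind]), and a cocone on it can be constructed vertex by vertex, each
    new vertex being subject to one commutativity condition only.

    Two such constructions are needed. Representatives of the stable cocone
    commute up to maps over bijective objects; these extend along pure
    monomorphisms, so that subtracting them yields a commutative cocone [h]
    into [T = X d] ([strictify_cocone]). Enlarging a bijective target at each
    leaf yields a commutative cocone [g] of pure monomorphisms into a bijective
    object [J] ([pure_mono_cocone]). Then [B] is the biproduct of [T] and [J]
    with the cocone [(h, g)]: the projection of [B] to [T] is a stable
    isomorphism, and a pair of maps is a pure monomorphism as soon as one
    of its components is ([pure_mono_pair]). *)

Set Implicit Arguments.
Unset Strict Implicit.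
Unset Printing Implicit Defensive.

Import Order.TTheory GRing.Theory.

Local Open Scope cat_scope.

(** * Componentwise 1-connected posets are forests *)

Section Forest.
Local Open Scope ring_scope.
Context {disp : Order.disp_t}.
Variable C : finPOrderType disp.
Implicit Types (S : {set C}) (v w : C).

Definition adjacent v w : bool := ((v < w) || (w < v))%O.

Definition edges_in S : {set nonid_mor C} :=
  [set e | ((val e).1 \in S) && ((val e).2 \in S)].

(** The incidence matrix of the comparability graph on [S] kills the column
    vector with all entries 1, so its rank is less than the number of vertices.
    If there were at least as many edges, its rows would be linearly dependent,
    and a relation between them is a nonzero element of the kernel of
    [crown_boundary]. *)
Lemma edges_lt_vertices S :
  componentwise_1_connected C -> S != set0 -> (#|edges_in S| < #|S|)%N.
Proof.
move=> injC S0; rewrite ltnNge; apply/negP => leSE.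
pose src (e : nonid_mor C) := (val e).1.
pose tgt (e : nonid_mor C) := (val e).2.
pose A : 'M[rat]_(#|edges_in S|, #|S|) := \matrix_(i, j)
  ((enum_val j == tgt (enum_val i))%:R - (enum_val j == src (enum_val i))%:R).
have sum_delta x : x \in S -> \sum_(j < #|S|) (enum_val j == x)%:R = 1 :> rat.
  move=> xS; rewrite (bigD1 (enum_rank_in xS x)) //= enum_rankK_in // eqxx.
  rewrite big1 ?addr0 // => j jx; case: (enum_val j =P x) => // xj.
  by case/eqP: jx; rewrite -[LHS](enum_valK_in xS) xj.
(* Every row has one entry 1 and one entry -1. *)
have A1 : A *m const_mx 1 = 0 :> 'M_(_, 1).
  apply/matrixP => i k; rewrite !mxE.
  have := enum_valP i; rewrite inE => /andP[sS tS].
  under eq_bigr do rewrite !mxE mulr1.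
  by rewrite sumrB !sum_delta ?subrr.
have rkA : (\rank A < #|S|)%N.
  rewrite ltn_neqAle rank_leq_col andbT; apply/negP => fullA.
  have [x xS] := set0Pn _ S0.
  have /matrixP := row_full_inj fullA (etrans A1 (esym (mulmx0 _ A))).
  by move=> /(_ (enum_rank_in xS x) 0)/eqP; rewrite !mxE oner_eq0.
have : kermx A != 0.
  by rewrite kermx_eq0 /row_free neq_ltn (leq_trans rkA leSE).
move=> /rowV0Pn[u /sub_kermxP uA u0].
have ES0 : (0 < #|edges_in S|)%N.
  by apply: leq_trans leSE; rewrite card_gt0.
have [e0 e0E] : exists e0, e0 \in edges_in S by apply/set0Pn; rewrite -card_gt0.
pose a : {ffun nonid_mor C -> rat^o} :=
  [ffun e => if e \in edges_in S then u 0 (enum_rank_in e0E e) else 0].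
have a0 : a = 0.
  apply: injC; rewrite {2}/crown_boundary big1 => [|e _]; last first.
    by rewrite ffunE scale0r.
  apply/ffunP => x; rewrite /crown_boundary sum_ffunE !ffunE.
  under eq_bigr do rewrite !ffunE.
  have -> : \sum_(e : nonid_mor C)
      (if e \in edges_in S then u 0 (enum_rank_in e0E e) else 0) *:
        (((x == tgt e)%:R : rat^o) - (x == src e)%:R)
    = \sum_(i < #|edges_in S|) u 0 i *
        ((x == tgt (enum_val i))%:R - (x == src (enum_val i))%:R).
    transitivity (\sum_(e in edges_in S) u 0 (enum_rank_in e0E e) *
        ((x == tgt e)%:R - (x == src e)%:R)).
      rewrite [RHS]big_mkcond; apply: eq_bigr => e _.
      by case: ifP => // _; rewrite scale0r.
    by rewrite big_enum_val; apply: eq_bigr => i _; rewrite enum_valK_in.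
  have [xS|xS] := boolP (x \in S).
    move/matrixP: uA => /(_ 0 (enum_rank_in xS x)); rewrite !mxE => uAx.
    rewrite -[RHS]uAx.
    by apply: eq_bigr => i _; rewrite !mxE enum_rankK_in.
  apply: big1 => i _.
  have := enum_valP i; rewrite inE => /andP[sS tS].
  rewrite (_ : x == tgt _ = false); last first.
    by apply/eqP => xt; rewrite xt tS in xS.
  rewrite (_ : x == src _ = false); last first.
    by apply/eqP => xs; rewrite xs sS in xS.
  by rewrite subrr mulr0.
case/eqP: u0; apply/rowP => i; rewrite mxE.
move/ffunP: a0 => /(_ (enum_val i)).
by rewrite !ffunE enum_valP enum_valK_in.
Qed.

Lemma sum_degrees S :
  (\sum_(v in S) #|[set w in S | adjacent v w]| = #|edges_in S|.*2)%N.
Proof.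
have cardE : #|edges_in S| = (\sum_(v in S) \sum_(w in S) (v < w)%O)%N.
  rewrite pair_big /= -big_mkcondr -(card_imset _ val_inj) -sum1_card.
  apply: eq_bigl => -[v w]; apply/imsetP/idP => [[e + ->]|/= vw].
    by rewrite inE => ->; exact: (valP e).
  have /andP[vwS ltvw] := vw.
  by exists (Sub (v, w) ltvw); rewrite ?inE ?SubK.
rewrite -addnn {2}cardE exchange_big cardE -big_split /=.
apply: eq_bigr => v _; rewrite -big_split /= -sum1_card.
rewrite [LHS](eq_bigl (fun w => (w \in S) && adjacent v w)); last first.
  by move=> w; rewrite inE.
rewrite big_mkcondr; apply: eq_bigr => w _; rewrite /adjacent.
by case: (comparableP v w).
Qed.

(** Otherwise all vertices have degree at least 2, and by [sum_degrees] there
    would be at least as many edges as vertices. *)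
Lemma exists_leaf S : componentwise_1_connected C -> S != set0 ->
  exists2 v, v \in S & (#|[set w in S | adjacent v w]| <= 1)%N.
Proof.
move=> C1 S0; apply/exists_inP; apply: contraT.
rewrite negb_exists_in => /forall_inP deg2.
have /negP[] : ~~ (#|edges_in S| < #|S|)%N; last exact: edges_lt_vertices.
rewrite -leqNgt -leq_double -sum_degrees -mul2n mulnC -sum_nat_const.
by apply: leq_sum => v vS; rewrite ltnNge deg2.
Qed.

(** The ways in which a new vertex [v] can be joined to [S] without creating a
    cycle. The direction of the edge is recorded because a map can always be
    restricted along it, but in general not extended. *)
Variant leaf_spec S v : Prop :=
  | LeafIsolated of forall w, w \in S -> ~~ adjacent v w
  | LeafBelow w of w \in S & (v < w)%O &
      forall w', w' \in S -> adjacent v w' -> w' = w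
  | LeafAbove w of w \in S & (w < v)%O &
      forall w', w' \in S -> adjacent v w' -> w' = w.

(** Removing leaves one by one from the whole poset and reversing the order
    gives an enumeration in which each vertex is a leaf when it is added. *)
Lemma leaf_ind (Q : {set C} -> Prop) : componentwise_1_connected C ->
  Q set0 ->
  (forall S v, v \notin S -> leaf_spec S v -> Q S -> Q (v |: S)) ->
  Q setT.
Proof.
move=> C1 Q0 Qstep.
suff: forall n S, #|S| = n -> Q S by move=> /(_ _ _ erefl).
elim=> [|n IHn] S Sn; first by rewrite (cards0_eq Sn).
have [|v vS deg1] := exists_leaf C1 (_ : S != set0).
  by rewrite -card_gt0 Sn.
rewrite -(setD1K vS); apply: Qstep; first by rewrite !inE eqxx.
  have uniq w w' : w \in S :\ v -> adjacent v w ->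
      w' \in S :\ v -> adjacent v w' -> w' = w.
    rewrite !inE => /andP[_ wS] vw /andP[_ w'S] vw'.
    by apply: (card_le1_eqP deg1); rewrite inE ?wS ?w'S.
  have [/existsP[w /andP[wS vw]]|] :=
      boolP [exists w, (w \in S :\ v) && adjacent v w].
    have /orP[lt|lt] := vw.
      by apply: LeafBelow lt _ => // w' w'S; exact: uniq.
    by apply: LeafAbove lt _ => // w' w'S; exact: uniq.
  rewrite negb_exists => /forallP no.
  by apply: LeafIsolated => w wS; have := no w; rewrite wS.
by apply: IHn; apply: succn_inj; rewrite -Sn (cardsD1 v S) vS.
Qed.

End Forest.

(** * Pure monomorphisms and null maps *)

Section PureMonos.
Local Open Scope ring_scope.
Variable E : exact_category.
Implicit Types X Y Z W T J B : E.

Lemma biproduct_swap X Y B (i : X ~> B) (j : Y ~> B) p q :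
  is_biproduct i j p q -> is_biproduct j i q p.
Proof. by case=> pi qj qi pj B1; split=> //; rewrite addrC. Qed.

Lemma pure_mono_comp X Y Z (g : Y ~> Z) (f : X ~> Y) :
  pure_mono g -> pure_mono f -> pure_mono (g \oc f).
Proof. exact: exact_mono_comp (pure_sesP E) _ _ _ _ _. Qed.

Lemma pure_mono_id X : pure_mono (idm X).
Proof.
have [Z Z0] := zero_object E.
exists Z, 0; apply: (exact_split (pure_sesP E) (j := 0) (p := idm X)).
by split; rewrite ?comp0m ?compm0 ?comp1m ?compm1 ?addr0.
Qed.

(** The composite with the projection to [J] is the pure monomorphism [g], so
    by the cancellation axiom it suffices that $(f, g)$ has a cokernel: the
    difference of the two maps into the pushout of [f] and [g]. *)
Lemma pure_mono_pair X T J B (i : T ~> B) (j : J ~> B) p q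
    (f : X ~> T) (g : X ~> J) :
  is_biproduct i j p q -> pure_mono g -> pure_mono (i \oc f + j \oc g).
Proof.
move=> [pi qj qi pj B1] pure_g.
have [P [f' [g' [[g'g uP] _]]]] := exact_mono_pushout (pure_sesP E) f pure_g.
apply: (exact_mono_cancel (pure_sesP E) (f := q)); last first.
  by rewrite compDr !compA qi qj comp0m comp1m add0r.
exists P, (f' \oc p - g' \oc q); split.
  rewrite compDr !compBl -!compA !(compA p) !(compA q) pi qj qi pj.
  by rewrite !comp0m !comp1m !compm0 subr0 sub0r g'g subrr.
move=> W h; rewrite compDr => /eqP; rewrite addr_eq0 => /eqP hij.
have [|k [[kg' kf'] k_uniq]] := uP W (- (h \oc j)) (h \oc i).
  by rewrite compNm -!compA -hij.
exists k; split=> [|k' kk'].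
  rewrite compBr !compA kg' kf' compNm opprK -!compA -compDr B1.
  by rewrite compm1.
apply: k_uniq; rewrite -kk'; split; rewrite -compA compBl -!compA.
  by rewrite pj qj compm0 compm1 sub0r compmN opprK.
by rewrite pi qi compm0 compm1 subr0.
Qed.

(** A bijective summand is zero in the stable category, so the projection to the
    other summand is a stable isomorphism; this is the half of the statement
    that does not already hold in [E]. *)
Lemma residue_inclusion_projection X T J B (i : T ~> B) (j : J ~> B) p q :
  is_biproduct i j p q -> bijective_object J ->
  stable_comp (residue i) (residue p) = residue (idm B).
Proof.
move=> [_ _ _ _ B1] bijJ; rewrite -residue_comp; apply/residue_eq.
exists J, (- q), j; split=> //.
by rewrite -B1 opprD addrA subrr sub0r compmN.
Qed.

Lemma null_extension X Y T (x : X ~> Y) (n : X ~> T) :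
  pure_mono x -> factors_over_bijective n ->
  exists2 n' : Y ~> T, factors_over_bijective n' & n' \oc x = n.
Proof.
move=> pure_x [N [u [v [bijN ->]]]].
have [u' u'x] := bijN.2 _ _ x u pure_x.
by exists (v \oc u'); [exists N, u', v | rewrite -compA u'x].
Qed.

(** A triangle that commutes stably can be made commutative by changing the map
    that starts at the target of the pure monomorphism, because the null error
    term extends. *)
Lemma adjust_along_pure_mono X Y T (x : X ~> Y) (f : Y ~> T) (h : X ~> T) :
  pure_mono x -> residue (f \oc x) = residue h ->
  exists2 f' : Y ~> T, residue f' = residue f & f' \oc x = h.
Proof.
move=> pure_x /residue_eq/(null_extension pure_x)[n null_n nx].
exists (f - n); last by rewrite compBl nx subKr.
by apply/esym/residue_eq; rewrite subKr.
Qed.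

End PureMonos.

(** * Cocones on forests *)

Section Cocones.
Context {disp : Order.disp_t}.
Variables (C : finPOrderType disp) (E : category).
Variables (Z : C -> E) (z : forall c c' : C, Z c ~> Z c').

Definition cocone_on (S : {set C}) (T : E) (h : forall c, Z c ~> T) : Prop :=
  forall c c', c \in S -> c' \in S -> (c < c')%O -> h c' \oc z c c' = h c.

Lemma cocone_onU1 (S : {set C}) (v : C) (T : E) (h : forall c, Z c ~> T)
    (hv : Z v ~> T) :
  v \notin S -> cocone_on S h ->
  (forall w, w \in S -> (v < w)%O -> h w \oc z v w = hv) ->
  (forall w, w \in S -> (w < v)%O -> hv \oc z w v = h w) ->
  cocone_on (v |: S) (dfwith h hv).
Proof.
move=> vS hS up down c c'; rewrite !inE.
case: (eqVneq c v) => [->|cv]; case: (eqVneq c' v) => [->|c'v] //=.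
- by rewrite ltxx.
- by move=> _ c'S lt; rewrite dfwith_in dfwith_out 1?eq_sym // up.
- by move=> cS _ lt; rewrite dfwith_in dfwith_out 1?eq_sym // down.
- move=> cS c'S lt; rewrite !dfwith_out 1?eq_sym //; exact: hS.
Qed.

End Cocones.

Section ForestCocones.
Local Open Scope ring_scope.
Context {disp : Order.disp_t}.
Variables (C : finPOrderType disp) (E : frobenius_category).
Variables (Z : C -> E) (z : forall c c' : C, Z c ~> Z c').
Hypothesis connC : componentwise_1_connected C.
Hypothesis pure_z : forall c c' : C, (c < c')%O -> pure_mono (z c c').

(** When a leaf [v] above [w] is added, the map at [v] is corrected by a null
    map so as to restrict to the map already chosen at [w]. When [v] lies below
    [w], the map at [v] is the restriction of the one at [w]. *)
Lemma strictify_cocone (T : E) (f : forall c, Z c ~> T) :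
  (forall c c', (c < c')%O -> residue (f c' \oc z c c') = residue (f c)) ->
  exists2 h : forall c, Z c ~> T, forall c, residue (h c) = residue (f c) &
    cocone_on z setT h.
Proof.
move=> fz.
apply: (leaf_ind (Q := fun S => exists2 h : forall c, Z c ~> T,
  forall c, residue (h c) = residue (f c) & cocone_on z S h)) => //.
  by exists f => // c c'; rewrite inE.
move=> S v vS leaf [h hf hS].
suff [hv hvf [up down]] : exists2 hv : Z v ~> T, residue hv = residue (f v) &
    (forall w, w \in S -> (v < w)%O -> h w \oc z v w = hv) /\
    (forall w, w \in S -> (w < v)%O -> hv \oc z w v = h w).
  exists (dfwith h hv); last exact: cocone_onU1.
  move=> c; case: (eqVneq c v) => [->|cv]; first by rewrite dfwith_in.
  by rewrite dfwith_out // eq_sym.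
case: leaf => [iso|w wS vw uniq|w wS wv uniq].
- exists (f v) => //; split=> w wS lt; have := iso w wS;
    by rewrite /adjacent lt ?orbT.
- exists (h w \oc z v w); first by rewrite residue_comp hf -residue_comp fz.
  split=> w' w'S lt;
    have e : w' = w by apply: uniq; rewrite // /adjacent lt ?orbT.
    by rewrite e.
  by rewrite e (lt_gtF vw) in lt.
- have [|hv hvf hvz] :=
      adjust_along_pure_mono (pure_z wv) (f := f v) (h := h w).
    by rewrite fz // hf.
  exists hv => //.
  split=> w' w'S lt;
    have e : w' = w by apply: uniq; rewrite // /adjacent lt ?orbT.
    by rewrite e (lt_gtF wv) in lt.
  by rewrite e.
Qed.

(** When a leaf [v] is added, embed [Z v] by [e] into a bijective object [I] and
    enlarge [J] to the biproduct of [J] and [I]. The component of the new map at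
    [v] in [I] is [e], which makes it a pure monomorphism. The old maps receive
    a component [a \oc g w] in [I], where [a : J ~> I] is an extension of the
    component prescribed by [e] on the neighbour of [v], if there is one; they
    remain pure because of their component in [J]. *)
Lemma pure_mono_cocone :
  exists (J : E) (g : forall c, Z c ~> J),
    [/\ bijective_object J, forall c, pure_mono (g c) & cocone_on z setT g].
Proof.
suff [J [g [bijJ pure_g gT]]] : exists (J : E) (g : forall c, Z c ~> J),
    [/\ bijective_object J, forall c, c \in setT -> pure_mono (g c)
      & cocone_on z setT g].
  by exists J, g; split=> // c; apply: pure_g.
apply: (leaf_ind (Q := fun S => exists (J : E) (g : forall c, Z c ~> J),
    [/\ bijective_object J, forall c, c \in S -> pure_mono (g c)
      & cocone_on z S g])) => //.
  (* On no vertices, the zero object will do; the zero maps are placeholders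
     outside the set of treated vertices. *)
  have [O O0] := zero_object E; exists O, (fun _ => 0).
  by split=> [|c|c c']; rewrite ?inE //; exact: zero_bijective.
move=> S v vS leaf [J [g [bijJ pure_g gS]]].
have [I [e [bijI pure_e]]] := enough_bijectives_mono (Z v).
have [gv [a [up down]]] : exists (gv : Z v ~> J) (a : J ~> I),
    (forall w, w \in S -> (v < w)%O ->
       g w \oc z v w = gv /\ a \oc gv = e) /\
    (forall w, w \in S -> (w < v)%O ->
       gv \oc z w v = g w /\ a \oc g w = e \oc z w v).
  case: leaf => [iso|w wS vw uniq|w wS wv uniq].
  - exists 0, 0; split=> w wS lt; have := iso w wS;
      by rewrite /adjacent lt ?orbT.
  - have pure_gv : pure_mono (g w \oc z v w).
      by apply: pure_mono_comp (pure_z vw); apply: pure_g.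
    have [a ae] := bijI.2 _ _ _ e pure_gv.
    exists (g w \oc z v w), a.
    split=> w' w'S lt;
      have e' : w' = w by apply: uniq; rewrite // /adjacent lt ?orbT.
      by rewrite e'.
    by rewrite e' (lt_gtF vw) in lt.
  - have [gv gvz] := bijJ.2 _ _ _ (g w) (pure_z wv).
    have [a ae] := bijI.2 _ _ _ (e \oc z w v) (pure_g w wS).
    exists gv, a.
    split=> w' w'S lt;
      have e' : w' = w by apply: uniq; rewrite // /adjacent lt ?orbT.
      by rewrite e' (lt_gtF wv) in lt.
    by rewrite e'.
have [B [i [j [p [q bipB]]]]] := biproducts J I.
(* The map [(1, a)] into the biproduct, through which [J] is replaced by [B]. *)
pose s := i + j \oc a.
have pure_s : pure_mono s.
  rewrite /s -[i]compm1 addrC; apply: pure_mono_pair (biproduct_swap bipB) _.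
  exact: pure_mono_id.
exists B, (dfwith (fun c => s \oc g c) (i \oc gv + j \oc e)); split.
- exact: biproduct_bijective bipB bijJ bijI.
- move=> c; rewrite !inE.
  case: (eqVneq c v) => [->|cv] /=.
    by move=> _; rewrite dfwith_in; apply: pure_mono_pair bipB pure_e.
  move=> cS; rewrite dfwith_out 1?eq_sym //.
  exact: pure_mono_comp (pure_g c cS).
apply: cocone_onU1 => // [c c' cS c'S lt|w wS lt|w wS lt].
- by rewrite -compA gS.
- have [gvz <-] := up w wS lt.
  by rewrite -compA gvz compDl compA.
- have [gvz ag] := down w wS lt.
  by rewrite !compDl -!compA gvz -ag.
Qed.

End ForestCocones.

Section LiftCocone.
Local Open Scope ring_scope.
Context {disp : Order.disp_t}.
Variables (C : finPOrderType disp) (E : frobenius_category).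
Variables (Z : C -> E) (z : forall c c' : C, Z c ~> Z c').

(** The cocone into [T] made commutative by [strictify_cocone] need not consist
    of pure monomorphisms; pairing it with one into a bijective object repairs
    this and does not change [T] stably. *)
Lemma lift_stable_cocone (T : E) (f : forall c, Z c ~> T) :
  componentwise_1_connected C ->
  (forall c c' : C, (c < c')%O -> pure_mono (z c c')) ->
  (forall c c', (c < c')%O -> residue (f c' \oc z c c') = residue (f c)) ->
  exists (B : E) (t : B ~> T) (u : forall c, Z c ~> B),
    [/\ is_iso (residue t : hom (c := stable_category E) B T),
        forall c, pure_mono (u c), cocone_on z setT u
      & forall c, residue (t \oc u c) = residue (f c)].
Proof.
move=> C1 pure_z fz.
have [h hf hT] := strictify_cocone C1 pure_z fz.
have [J [g [bijJ pure_g gT]]] := pure_mono_cocone C1 pure_z.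
have [B [i [j [p [q bipB]]]]] := biproducts T J.
exists B, p, (fun c => i \oc h c + j \oc g c); split.
- exists (residue i); split.
    exact: residue_inclusion_projection bipB bijJ.
  by case: bipB => pi _ _ _ _; rewrite /= -residue_comp pi.
- by move=> c; apply: pure_mono_pair bipB (pure_g c).
- move=> c c' cT c'T lt.
  by rewrite compDl -!compA (hT _ _ cT c'T lt) (gT _ _ cT c'T lt).
- move=> c; case: bipB => pi _ _ pj _.
  by rewrite compDr !compA pi pj comp1m comp0m addr0 hf.
Qed.

End LiftCocone.

(** * From the ind-crown to the whole poset *)

Section CrownCocones.
Local Open Scope ring_scope.
Context {disp : Order.disp_t}.
Variables (D : finPOrderType disp) (E : exact_category).
Implicit Types (P : {set D}) (a b r : D).

Lemma exists_max_above P a :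
  a \in P -> exists2 m, m \in max_set P & (a <= m)%O.
Proof.
move=> aP.
have aP0 : (a \in P) && (a <= a)%O by rewrite aP lexx.
case: (@arg_maxnP _ a (fun m => (m \in P) && (a <= m)%O)
  (fun m => #|[set b | (b < m)%O]|) aP0) => m /andP[mP am] m_max.
exists m => //; rewrite inE mP; apply/forall_inP => b bP; apply/negP => mb.
have /m_max /= : (b \in P) && (a <= b)%O by rewrite bP (le_trans am (ltW mb)).
rewrite /geq /= leqNgt => /negP[]; apply: proper_card; apply/properP; split.
  by apply/subsetP => x; rewrite !inE => /lt_trans; apply.
by exists m; rewrite !inE ?ltxx.
Qed.

Lemma max_ind_crown P m : m \in max_set P -> m \in ind_crown_set P.
Proof.
move=> mM; apply/bigcupP; exists m => //; apply/bigcupP; exists m => //.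
have := mM; rewrite inE => /andP[mP /forall_inP m_max].
rewrite setIid !inE mP lexx; apply/forall_inP => b.
by rewrite !inE => /andP[bP _]; apply: m_max.
Qed.

Variables (P : {set D}) (Y : D -> E) (y : forall a b, Y a ~> Y b).
Hypothesis yM : forall a b c, (a <= b)%O -> (b <= c)%O -> c \in P ->
  y b c \oc y a b = y a c.

(** The map at [a] is the restriction of the map at some maximal element above
    [a]. It does not depend on that element: if [c] and [c'] are both maximal
    and above [a], then [a] lies below some maximal common lower bound [r] of
    them, which is an element of the crown, and both restrictions factor over
    the map at [r]. *)
Lemma cocone_of_crown_cocone (T : E)
    (u : forall c : ind_crown P, Y (val c) ~> T) :
  cocone_on (Z := fun c : ind_crown P => Y (val c))
    (fun c c' => y (val c) (val c')) setT u ->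
  exists h : forall a, Y a ~> T,
    (forall a, a \in P ->
       exists c, (a <= val c)%O /\ h a = u c \oc y a (val c)) /\
    (forall a b, b \in P -> a \in P -> (a <= b)%O -> h b \oc y a b = h a).
Proof.
move=> uC.
pose above a (c : ind_crown P) := (val c \in max_set P) && (a <= val c)%O.
have above_ex a : a \in P -> exists c, above a c.
  move=> /exists_max_above[m mM am].
  by exists (Sub m (max_ind_crown mM)); rewrite /above SubK mM am.
have max_in (c : ind_crown P) : val c \in max_set P -> val c \in P.
  by rewrite inE => /andP[].
have indep a c c' : a \in P -> above a c -> above a c' ->
    u c \oc y a (val c) = u c' \oc y a (val c').
  move=> aP /andP[cM ac] /andP[c'M ac'].
  have [->//|cc'] := eqVneq c c'.
  have : a \in down P (val c) :&: down P (val c') by rewrite !inE aP ac ac'.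
  move=> /exists_max_above[r rM ar].
  have /and3P[rP rc rc'] : [&& r \in P, r <= val c & r <= val c']%O.
    by move: rM; rewrite !inE => /andP[/andP[/andP[-> ->] /andP[_ ->]]].
  have rC : r \in ind_crown_set P.
    by apply/bigcupP; exists (val c) => //; apply/bigcupP; exists (val c').
  have max_eq (m m' : D) :
      m \in max_set P -> m' \in P -> (m <= m')%O -> m = m'.
    rewrite inE => /andP[_ /forall_inP m_max] m'P; rewrite le_eqVlt.
    by rewrite (negPf (m_max _ m'P)) orbF => /eqP.
  have ltrc : (r < val c)%O.
    rewrite lt_neqAle rc andbT; apply: contra_neqN cc' => /eqP rE.
    by apply/val_inj/max_eq; rewrite -?rE ?max_in // rE.
  have ltrc' : (r < val c')%O.
    rewrite lt_neqAle rc' andbT; apply: contra_neqN cc' => /eqP rE.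
    by apply/esym/val_inj/max_eq; rewrite -?rE ?max_in // rE.
  have rNM : r \notin max_set P.
    by apply/negP => /max_eq/(_ (max_in _ cM) rc) rE; rewrite rE ltxx in ltrc.
  pose r' : ind_crown P := Sub r rC.
  have lt : (r' < c)%O by apply/and3P; split; rewrite ?SubK.
  have lt' : (r' < c')%O by apply/and3P; split; rewrite ?SubK.
  rewrite -(yM ar rc (max_in _ cM)) -(yM ar rc' (max_in _ c'M)) !compA.
  by rewrite (uC r' c) ?inE // (uC r' c') ?inE.
pose h a := if [pick c | above a c] is Some c then u c \oc y a (val c) else 0.
have hE a c : a \in P -> above a c -> h a = u c \oc y a (val c).
  move=> aP ac; rewrite /h.
  by case: pickP => [c' ac'|/(_ c)/negP//]; exact: indep.
exists h; split=> [a aP|a b bP aP ab].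
  by have [c ac] := above_ex a aP; exists c; split; [case/andP: ac | exact: hE].
have [c /[dup] bc /andP[cM lebc]] := above_ex b bP.
rewrite (hE b c) // (hE a c) //; last by rewrite /above cM (le_trans ab).
by rewrite -compA yM // max_in.
Qed.

End CrownCocones.

(** * Lifting diagrams one element at a time *)

Section PartialLifts.
Context {disp : Order.disp_t}.
Variables (D : finPOrderType disp) (E : frobenius_category).
Variable X : functor (poset_category D) (stable_category E).
Implicit Types (S : {set D}) (a b c : D).

(** The objects, the maps and the stable comparison maps are total families, so
    that a diagram on a part of [D] needs no subtypes; their values are
    significant only on [S], which will be down-closed. *)
Record is_lift_on S (Y : D -> E) (y : forall a b, Y a ~> Y b)
    (phi : forall a, (Y a : stable_category E) ~> X a) : Prop := IsLiftOn {
  lift_id : forall a, a \in S -> y a a = idm (Y a);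
  lift_comp : forall a b c, (a <= b)%O -> (b <= c)%O -> c \in S ->
    y b c \oc y a b = y a c;
  lift_mono : forall a b, (a <= b)%O -> b \in S -> pure_mono (y a b);
  lift_iso : forall a, a \in S -> is_iso (phi a);
  lift_nat : forall (a b : poset_category D) (ab : a ~> b), b \in S ->
    phi b \oc (residue (y a b) : hom (c := stable_category E) _ _)
    = fmap X ab \oc phi a
}.

Definition liftable_on S : Prop :=
  exists Y y phi, @is_lift_on S Y y phi.

Lemma liftable_on0 : liftable_on set0.
Proof.
exists (fun a => X a), (fun a b => 0%R), (fun a => idm (X a)).
by split=> [a|a b c _ _|a b _|a|a b ab]; rewrite inE.
Qed.

(** The stable cocone on $\Lambda^0(d)$ given by [X] is lifted on the ind-crown,
    the lift is extended to all of $\Lambda^0(d)$, and its tip becomes the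
    object at [d]. *)
Lemma liftable_on_setU1 S d : ind_flat D ->
  d \notin S -> down0 setT d \subset S ->
  (forall a b, (a <= b)%O -> b \in S -> a \in S) ->
  liftable_on S -> liftable_on (d |: S).
Proof.
move=> flatD dS sub_dS S_down [Y [y [phi [y1 yM y_mono phi_iso phi_nat]]]].
pose P := down0 setT d.
have PS a : a \in P -> a \in S by apply/subsetP.
have Pd a : a \in P -> (a < d)%O by rewrite !inE.
have CP (c : ind_crown P) : val c \in P.
  case/bigcupP: (valP c) => p _ /bigcupP[q _].
  by rewrite !inE => /andP[/andP[/andP[]]].
have fmapXM a b c (ab : (a : poset_category D) ~> b)
    (bc : (b : poset_category D) ~> c) (ac : (a : poset_category D) ~> c) :
    fmap X bc \oc fmap X ab = fmap X ac.
  by rewrite -fmapM; congr (fmap X _); exact: bool_irrelevance.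
pose f (c : ind_crown P) : Y (val c) ~> (X d : E) :=
  repr (fmap X (ltW (Pd _ (CP c)) : hom (c := poset_category D) _ _)
    \oc phi (val c)).
have f_res (c : ind_crown P) (cd : (val c : poset_category D) ~> d) :
    residue (f c) = fmap X cd \oc phi (val c).
  by rewrite residue_repr; congr (fmap X _ \oc _); exact: bool_irrelevance.
have ltC (c c' : ind_crown P) : (c < c')%O -> (val c <= val c')%O.
  by case/and3P => /ltW.
have [|c c' lt|c c' lt|B [t [u [t_iso u_mono uC tu]]]] :=
  lift_stable_cocone (Z := fun c : ind_crown P => Y (val c))
    (z := fun c c' : ind_crown P => y (val c) (val c')) (f := f).
- exact: flatD.
- by apply: y_mono (ltC _ _ lt) _; exact/PS/CP.
- have c'd := ltW (Pd _ (CP c')); have cd := ltW (Pd _ (CP c)).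
  rewrite residue_comp (f_res c' c'd) (f_res c cd).
  rewrite -[LHS](compA (c := stable_category E)).
  rewrite (phi_nat _ _ (ltC _ _ lt)) ?PS ?CP //.
  by rewrite compA (fmapXM _ _ _ _ _ cd).
have [|h [h_crown hM]] := cocone_of_crown_cocone _ uC.
  by move=> a b c ab bc cP; apply: yM => //; apply: PS.
(* The comparison map at [d] as a member of a family indexed by all of [D], so
   that it can be used below in the branch where [a == d]. *)
have [t' t'd] : exists t' : forall a, (B : stable_category E) ~> X a,
    t' d = residue t.
  pose hom_to a := (B : stable_category E) ~> X a.
  exists (dfwith (T := hom_to) (fun a => residue 0%R) (residue t)).
  by rewrite dfwith_in.
have h_mono a : a \in P -> pure_mono (h a).
  move=> aP; have [c [ac ->]] := h_crown a aP.
  by apply: pure_mono_comp (u_mono c) _; apply: y_mono => //; exact/PS/CP.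
have h_nat a (ad : (a : poset_category D) ~> d) : a \in P ->
    residue (t \oc h a) = fmap X ad \oc phi a.
  move=> aP; have [c [ac ->]] := h_crown a aP.
  have cd := ltW (Pd _ (CP c)).
  rewrite compA residue_comp tu (f_res c cd).
  rewrite -[LHS](compA (c := stable_category E)).
  by rewrite (phi_nat _ _ ac) ?PS ?CP // compA (fmapXM _ _ _ _ _ ad).
exists (fun a => if a == d then B else Y a).
(* The value 0 is a dummy: nothing in [S] lies above [d]. *)
exists (fun a b =>
  match a == d as da, b == d as db
    return (if da then B else Y a) ~> (if db then B else Y b) with
  | true, true => idm B
  | false, true => h a
  | true, false => 0%R
  | false, false => y a b
  end).
exists (fun a =>
  match a == d as da
    return ((if da then B else Y a) : stable_category E) ~> X a with
  | true => t' a
  | false => phi a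
  end).
have notleS a : a \in S -> (d <= a)%O = false.
  by move=> aS; apply/negP => /S_down/(_ aS); exact/negP.
have inP a : a != d -> (a <= d)%O -> a \in P.
  by rewrite !inE lt_neqAle => -> ->.
split.
- by move=> a; rewrite !inE; case: eqP => //= _ aS; exact: y1.
- move=> a b c ab bc; rewrite !inE.
  case: (eqVneq a d) => [ad|ad]; case: (eqVneq b d) => [bd|bd];
    case: (eqVneq c d) => [cd|cd] //= cS; rewrite ?comp1m ?compm1 ?compm0 //.
  + move: ab bc; rewrite ad cd => db bd'; case/eqP: bd.
    by apply: le_anti; rewrite bd'.
  + by move: bc; rewrite bd notleS.
  + by apply: hM; rewrite ?inP -?cd ?(le_trans ab) // cd.
  + exact: yM.
- move=> a b ab; rewrite !inE.
  case: (eqVneq a d) => [ad|ad]; case: (eqVneq b d) => [bd|bd] //= bS.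
  + exact: pure_mono_id.
  + by move: ab; rewrite ad notleS.
  + by apply/h_mono/inP => //; rewrite -bd.
  + exact: y_mono.
- move=> a; rewrite !inE; case: (eqVneq a d) => [->|ad] //= aS.
    by rewrite t'd.
  exact: phi_iso.
- move=> a b ab; rewrite !inE.
  case: (eqVneq a d) => [ad|ad]; case: (eqVneq b d) => [bd|bd] //= bS.
  + subst a b.
    have -> : ab = idm (d : poset_category D) by exact: bool_irrelevance.
    rewrite fmap1; transitivity (t' d).
      exact: (compm1 (c := stable_category E)).
    by symmetry; apply: (comp1m (c := stable_category E)).
  + by move: (notleS _ bS); rewrite -ad (ab : (a <= b)%O).
  + subst b; rewrite t'd -residue_comp; exact: h_nat (inP _ ad ab).
  + exact: phi_nat.
Qed.

(** An element outside [S] with fewest elements below it has everything below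
    it in [S], and adding it keeps [S] down-closed. *)
Lemma liftable_on_setT : ind_flat D -> liftable_on setT.
Proof.
move=> flatD.
suff: forall n S, #|~: S| = n ->
    (forall a b, (a <= b)%O -> b \in S -> a \in S) ->
    liftable_on S -> liftable_on setT.
  move=> /(_ _ _ erefl); apply; last exact: liftable_on0.
  by move=> a b _; rewrite inE.
elim=> [|n IHn] S Sn S_down liftS.
  by rewrite -[setT](setCK _) setCT -(cards0_eq Sn) setCK.
have [d0 d0S] : exists d0, d0 \notin S.
  have /card_gt0P[d0] : (0 < #|~: S|)%N by rewrite Sn.
  by rewrite inE; exists d0.
case: (@arg_minnP _ d0 (fun d => d \notin S) (fun d => #|down0 setT d|) d0S).
move=> d dS d_min.
have sub_dS : down0 setT d \subset S.
  apply/subsetP => a; rewrite !inE /= => ad; apply: contraT => /d_min.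
  rewrite leqNgt => /negP[]; apply: proper_card; apply/properP; split.
    by apply/subsetP => x; rewrite !inE => /lt_trans; apply.
  by exists a; rewrite !inE ?ltxx.
apply: (IHn (d |: S)); last exact: liftable_on_setU1.
  apply: succn_inj; rewrite -Sn (cardsD1 d (~: S)) inE dS add1n.
  by congr (_.+1); apply: eq_card => x; rewrite !inE negb_or.
move=> a b ab; rewrite !inE => /orP[/eqP bd|/(S_down _ _ ab)->];
  last by rewrite orbT.
have [//|ad /=] := eqVneq a d.
by apply: (subsetP sub_dS); rewrite !inE lt_neqAle ad -bd.
Qed.

End PartialLifts.

Lemma nat_trans_iso (C D : category) (F G : functor C D) (s : nat_trans F G) :
  (forall A, is_iso (s A)) -> is_iso (s : hom (c := functor_category C D) F G).
Proof.
move=> s_iso; pose t A := sval (cid (s_iso A)).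
have tP A : t A \oc s A = idm (F A) /\ s A \oc t A = idm (G A).
  exact: svalP (cid (s_iso A)).
have tN (A B : C) (f : A ~> B) : t B \oc fmap G f = fmap F f \oc t A.
  have [_ stA] := tP A; have [tsB _] := tP B.
  rewrite -[LHS]compm1 -{1}stA -compA (compA (fmap G f)).
  by rewrite -naturality !compA tsB comp1m.
by exists (NatTrans tN); split; apply: nat_transP => A; have [] := tP A.
Qed.

Theorem theorem3p1 (disp : Order.disp_t) (D : finPOrderType disp)
    (E : frobenius_category) :
  ind_flat D -> dense_functor (mono_residue D E).
Proof.
move=> flatD X.
have [Y [y [phi liftY]]] := liftable_on_setT X flatD.
pose F := @Functor (poset_category D) E Y (fun a b _ => y a b)
  (fun a => lift_id liftY (in_setT a))
  (fun a b c bc ab => esym (lift_comp liftY ab bc (in_setT c))).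
have F_mono : is_mono_diagram F.
  by move=> a b ab; apply: (lift_mono liftY).
pose FX : mono_diagrams D E := exist _ F F_mono.
exists FX, (@NatTrans _ _ (mono_residue D E FX) X phi
  (fun a b ab => lift_nat liftY ab (in_setT b))).
by apply: nat_trans_iso => a; apply: (lift_iso liftY).
Qed.
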